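(* For $q=1,\dots,N$ define vectors $\theta^{\{q\}}(\mathfrak t)\in\mathbb R^{s^{\{q\}}}$ for $\mathfrak t\in\mathbb T_N$ recursively by: $\theta^{\{q\}}(\emptyset)=0$; $\theta^{\{q\}}(\tau_{\bigcirc q})=\mathbf 1^{\{q\}}$; $\theta^{\{q\}}([\mathfrak t_1]_{\bigcirc q})=\sum_{m=1}^N\beta^{\{q,m\}}\theta^{\{m\}}(\mathfrak t_1)$; $\theta^{\{q\}}([\mathfrak t_1,\dots,\mathfrak t_L]_{\bigcirc q})=\times_{\ell=1}^L\big(\sum_{m=1}^N\alpha^{\{q,m\}}\theta^{\{m\}}(\mathfrak t_\ell)\big)$ for $L\ge2$; and $\theta^{\{q\}}(\mathfrak t)=0$ whenever the root of $\mathfrak t$ does not have color $q$. Then the GARK-ROS method has order of consistency $p$ (for all smooth $\mathbf f^{\{1\}},\dots,\mathbf f^{\{N\}}$) if and only if $$\sum_{m=1}^N b^{\{m\}T}\theta^{\{m\}}(\mathfrak t)=\frac{1}{\gamma(\mathfrak t)}\quad\text{for all }\mathfrak t\in\mathbb T_N\text{ with }1\le\rho(\mathfrak t)\le p.$$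
   Context: Problem: $\mathbf y'=\sum_{m=1}^N\mathbf f^{\{m\}}(\mathbf y)$, $\mathbf y\in\mathbb R^d$, smooth $\mathbf f^{\{m\}}$. GARK-ROS method: for each $q$ a number of stages $s^{\{q\}}$, weights $b^{\{q\}}\in\mathbb R^{s^{\{q\}}}$, and coefficient matrices $\alpha^{\{q,m\}},\gamma^{\{q,m\}}\in\mathbb R^{s^{\{q\}}\times s^{\{m\}}}$ with $\alpha^{\{q,m\}}_{i,j}=0$ for $j\ge i$ and $\gamma^{\{q,m\}}_{i,j}=0$ for $j>i$; $\beta^{\{q,m\}}=\alpha^{\{q,m\}}+\gamma^{\{q,m\}}$. One step: $k_i^{\{q\}}=h\,\mathbf f^{\{q\}}\big(\mathbf y_n+\sum_{m=1}^N\sum_{j=1}^{i-1}\alpha^{\{q,m\}}_{i,j}k_j^{\{m\}}\big)+h\,\mathbf J_n^{\{q\}}\sum_{m=1}^N\sum_{j=1}^{i}\gamma^{\{q,m\}}_{i,j}k_j^{\{m\}}$, $i=1,\dots,s^{\{q\}}$, $q=1,\dots,N$, and $\mathbf y_{n+1}=\mathbf y_n+\sum_{q}\sum_i b^{\{q\}}_ik_i^{\{q\}}$, where $\mathbf J_n^{\{q\}}=\partial\mathbf f^{\{q\}}/\partial\mathbf y(\mathbf y_n)$. Order $p$ means the local error $\mathbf y_{n+1}-\mathbf y(t_n+h)$ with $\mathbf y(t_n)=\mathbf y_n$ is $O(h^{p+1})$. $\mathbf 1^{\{q\}}\in\mathbb R^{s^{\{q\}}}$ is the vector of ones; $\times$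 denotes componentwise product of vectors. Trees: $\mathbb T_N$ is the set of rooted trees (including the empty tree $\emptyset$) whose vertices are colored with colors $1,\dots,N$; $\tau_{\bigcirc m}$ is the single vertex of color $m$; $[\mathfrak t_1,\dots,\mathfrak t_L]_{\bigcirc m}$ attaches nonempty trees $\mathfrak t_1,\dots,\mathfrak t_L$ as children of a new root of color $m$. $\rho(\mathfrak t)$ is the number of vertices; the density $\gamma(\mathfrak t)$ (not to be confused with the matrices $\gamma^{\{q,m\}}$) is defined by $\gamma(\emptyset)=\gamma(\tau_{\bigcirc m})=1$, $\gamma([\mathfrak t_1,\dots,\mathfrak t_L]_{\bigcirc m})=\rho(\mathfrak t)\gamma(\mathfrak t_1)\cdots\gamma(\mathfrak t_L)$. *)

(* Defs.v *)
From HB Require Import structures.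
From mathcomp Require Import all_boot all_order all_algebra.
From mathcomp Require Import all_classical all_reals all_analysis.
Set Implicit Arguments. Unset Strict Implicit. Unset Printing Implicit Defensive.
Import Order.TTheory GRing.Theory Num.Theory.
Import numFieldNormedType.Exports.
Local Open Scope ring_scope.

(* CNode m [:: t_1; ...; t_L] is [t_1,...,t_L]_(m) ; CNode m [::] is tau_(m).
   Children are kept as a list; all quantities below are invariant under
   permutation of the children, so ranging over all lists covers every tree
   of T_N \ {empty}. *)
Inductive ctree (N : nat) : Type := CNode of 'I_N & seq (ctree N).

Fixpoint rho N (t : ctree N) : nat :=
  let: CNode _ ch := t in (sumn (map (@rho N) ch)).+1.

Fixpoint tdens N (t : ctree N) : nat :=
  let: CNode _ ch := t in rho t * foldr muln 1%N (map (@tdens N) ch).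

Definition hprod (R : ringType) n (vs : seq 'cV[R]_n) : 'cV[R]_n :=
  \col_i \prod_(v <- vs) v i 0.

Fixpoint theta (R : ringType) N (s : 'I_N -> nat)
  (alpha beta : forall q m : 'I_N, 'M[R]_(s q, s m)) (t : ctree N)
  : forall q : 'I_N, 'cV[R]_(s q) :=
  let: CNode c ch := t in
  fun q =>
    if c == q then
      match ch with
      | [::] => const_mx 1
      | [:: t1] => \sum_(m < N) beta q m *m theta alpha beta t1 m
      | _ => hprod [seq \sum_(m < N) alpha q m *m theta alpha beta t' m | t' <- ch]
      end
    else 0.

Fixpoint iderive (R : realType) (V W : normedModType R) (vs : seq V) (g : V -> W)
  : V -> W :=
  match vs with
  | [::] => g
  | v :: vs' => fun x => 'D_v (iderive vs' g) x
  end.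

Definition smooth (R : realType) (V W : normedModType R) (g : V -> W) : Prop :=
  forall vs : seq V, continuous (iderive vs g) /\
                     (forall v x, derivable (iderive vs g) x v).

Section GarkRos.
Variables (R : realType) (N d : nat) (s : 'I_N -> nat).
Variables (b : forall q : 'I_N, 'cV[R]_(s q))
          (alpha gamma : forall q m : 'I_N, 'M[R]_(s q, s m)).

Definition jac (g : 'rV[R]_d -> 'rV[R]_d) (y w : 'rV[R]_d) : 'rV[R]_d := 'D_w g y.

Definition stage_eqs (f : 'I_N -> 'rV[R]_d -> 'rV[R]_d) (y0 : 'rV[R]_d) (h : R)
    (k : forall q : 'I_N, 'I_(s q) -> 'rV[R]_d) : Prop :=
  forall (q : 'I_N) (i : 'I_(s q)),
    k q i =
      h *: f q (y0 + \sum_(m < N) \sum_(j < s m | (j < i)%N) alpha q m i j *: k m j)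
    + h *: jac (f q) y0 (\sum_(m < N) \sum_(j < s m | (j <= i)%N) gamma q m i j *: k m j).

Definition step (y0 : 'rV[R]_d) (k : forall q : 'I_N, 'I_(s q) -> 'rV[R]_d) : 'rV[R]_d :=
  y0 + \sum_(q < N) \sum_(i < s q) b q i 0 *: k q i.

End GarkRos.

Definition has_order (R : realType) (N : nat) (s : 'I_N -> nat)
  (b : forall q : 'I_N, 'cV[R]_(s q))
  (alpha gamma : forall q m : 'I_N, 'M[R]_(s q, s m)) (p : nat) : Prop :=
  forall (d : nat) (f : 'I_N -> 'rV[R]_d -> 'rV[R]_d),
    (forall m, smooth (f m)) ->
  forall (y0 : 'rV[R]_d) (y : R -> 'rV[R]_d) (T : R),
    0 < T -> y 0 = y0 ->
    (forall t, -T < t < T -> is_derive t 1 y (\sum_(m < N) f m (y t))) ->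
  exists (C h0 : R), 0 < h0 /\
    forall (h : R) (k : forall q : 'I_N, 'I_(s q) -> 'rV[R]_d),
      0 < h < h0 -> stage_eqs alpha gamma f y0 h k ->
      `| step b y0 k - y h | <= C * h ^+ p.+1.

(* Main.v *)
Require Import Defs.
From HB Require Import structures.
From mathcomp Require Import all_boot all_order all_algebra.
From mathcomp Require Import all_classical all_reals all_analysis.
From mathcomp Require Import ring lra.
Import Order.TTheory GRing.Theory Num.Theory.
Import numFieldNormedType.Exports.
Local Open Scope ring_scope.
Set Implicit Arguments. Unset Strict Implicit. Unset Printing Implicit Defensive.

(** Sufficiency. Write F([t_1,...,t_L]_m) for the L-th derivative of f_m at y_0 in the
    directions F(t_1),...,F(t_L), and w(t) for the product of 1/L! over the vertices of t,
    L being the number of children. Substituting an expansion with error O(h^(n+1)) into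
    the Taylor formula of f_m and using multilinearity only, one gets by induction on n
      k^q_i = sum_t w(t) theta^q(t)_i h^rho(t) F(t) + O(h^(n+1)),
      y(h) = y_0 + sum_t w(t)/gamma(t) h^rho(t) F(t) + O(h^(n+1)),
    where t ranges over ordered trees, so that neither symmetry coefficients nor the
    symmetry of higher derivatives is needed. The Jacobian term of the stages only meets
    the trees whose root has one child, which turns alpha into beta there. The order
    conditions make the two expansions agree up to order p.

    Necessity. For a tree t_0, take one unknown y_u for each subtree u of t_0 and let
    y_u' be the product of the unknowns of the children of u, put in the summand f_m for
    m the color of the root of u. From y_0 = 0 the exact solution is
    y_u(h) = h^rho(u)/gamma(u), and the stages are exactly h^rho(u) theta^q(u)_i, so the
    component t_0 of the error is h^rho(t_0) times the defect of the order condition. *)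

(** * Smooth maps *)

Lemma le_coord_norm (R : realType) d (x : 'rV[R]_d) i : `|x 0 i| <= `|x|.
Proof.
rewrite [leRHS]/Num.Def.normr/= mx_normrE.
exact: (le_bigmax _ (fun ij : 'I_1 * 'I_d => `|x ij.1 ij.2|) (0, i)).
Qed.

Lemma norm_le_coord (R : realType) d (x : 'rV[R]_d) c :
  0 <= c -> (forall i, `|x 0 i| <= c) -> `|x| <= c.
Proof.
move=> c0 xc; rewrite [leLHS]/Num.Def.normr/= mx_normrE.
by apply: bigmax_le => // -[i j] _ /=; rewrite ord1.
Qed.

Section Derivatives.
Local Open Scope classical_set_scope.
Variables (R : realType) (V W : normedModType R).
Implicit Types (g : V -> W) (x v w : V).

Lemma is_derive_line g x v (t : R) : derivable g (x + t *: v) v ->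
  is_derive t 1 (fun s : R => g (x + s *: v)) ('D_v g (x + t *: v)).
Proof.
move=> dg.
have E : (fun h : R => h^-1 *:
    (((fun s : R => g (x + s *: v)) \o shift t) (h *: 1) - g (x + t *: v)))
    = (fun h : R => h^-1 *: ((g \o shift (x + t *: v)) (h *: v) - g (x + t *: v))).
  apply/funext => h /=; congr (_ *: (g _ - _)).
  by rewrite [h *: 1]mulr1 scalerDl addrCA.
by split; rewrite /derivable /derive E.
Qed.

(** For k nonzero, the difference quotient along [k *: v] at h is k times the one along [v] at h k,
    and h k tends to 0 through nonzero values. *)
Lemma is_derive_scale_dir g x v (k : R) :
  derivable g x v -> is_derive x (k *: v) g (k *: 'D_v g x).
Proof.
move=> dg; have [->|k0] := eqVneq k 0.
  by rewrite !scale0r; exact: is_derive0.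
suff H : (fun h : R => h^-1 *: ((g \o shift x) (h *: (k *: v)) - g x)) @ 0^'
    --> k *: 'D_v g x.
  by split; [apply/cvg_ex; exists (k *: 'D_v g x) | exact: cvg_lim].
have E : (fun h : R => h^-1 *: ((g \o shift x) (h *: (k *: v)) - g x)) =
    (fun h => k *: ((h * k)^-1 *: ((g \o shift x) ((h * k) *: v) - g x))).
  apply/funext => h /=; rewrite scalerA scalerA; congr (_ *: _).
  by rewrite invfM mulrCA mulfV// mulr1.
rewrite E; apply: cvgZr => //.
apply: (@cvg_comp _ _ _ (fun h : R => h * k)
  (fun h : R => h^-1 *: ((g \o shift x) (h *: v) - g x)) _ 0^'); last exact: dg.
move=> A; rewrite /= /nbhs/= /dnbhs /within /= => /nbhs_ballP[e /= e0 eA].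
apply/nbhs_ballP; exists (e / `|k|) => /=; first by rewrite divr_gt0 ?normr_gt0.
move=> h; rewrite /ball/= sub0r normrN ltr_pdivlMr ?normr_gt0// => hk h0.
apply: eA; last by rewrite mulf_neq0.
by rewrite /ball/= sub0r normrN normrM.
Qed.

Lemma derive_scale_dir g x v (k : R) :
  derivable g x v -> 'D_(k *: v) g x = k *: 'D_v g x.
Proof. by move=> /(is_derive_scale_dir k) /@derive_val. Qed.

Lemma is_derive_bigsum (I : Type) (r : seq I) (G : I -> V -> W) (dG : I -> W) x v :
  (forall i, is_derive x v (G i) (dG i)) ->
  is_derive x v (fun z => \sum_(i <- r) G i z) (\sum_(i <- r) dG i).
Proof.
move=> dGP; elim: r => [|i r IH].
  rewrite big_nil (_ : (fun _ => _) = cst 0); first exact: is_derive_cst.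
  by apply/funext => z; rewrite big_nil.
rewrite big_cons (_ : (fun _ => _) = G i + (fun z => \sum_(i <- r) G i z)).
  exact: is_deriveD.
by apply/funext => z; rewrite big_cons.
Qed.

Lemma is_derive_lincomb (I : Type) (r : seq I) (c : I -> R) (G : I -> V -> W) x v :
  (forall i, derivable (G i) x v) ->
  is_derive x v (fun z => \sum_(i <- r) c i *: G i z)
    (\sum_(i <- r) c i *: 'D_v (G i) x).
Proof.
by move=> dG; apply: is_derive_bigsum => i; apply/is_deriveZ/derivableP.
Qed.

Lemma is_derive_scalel (k : V -> R) (dk : R) (c : W) x v :
  is_derive x v k dk -> is_derive x v (fun z => k z *: c) (dk *: c).
Proof.
case=> ex <-.
suff H : (fun h : R => h^-1 *: (((fun z => k z *: c) \o shift x) (h *: v) - k x *: c))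
    @ 0^' --> 'D_v k x *: c.
  by split; [apply/cvg_ex; exists ('D_v k x *: c) | exact: cvg_lim].
have -> : (fun h : R => h^-1 *: (((fun z => k z *: c) \o shift x) (h *: v) - k x *: c))
    = (fun h : R => (h^-1 *: ((k \o shift x) (h *: v) - k x)) *: c).
  by apply/funext => h /=; rewrite -scalerBl scalerA.
exact: cvgZl.
Qed.

Lemma iderive_rcons (vs : seq V) v g : iderive (rcons vs v) g = iderive vs ('D_v g).
Proof. by elim: vs => //= u vs ->. Qed.

Lemma smooth_continuous g : smooth g -> continuous g.
Proof. by case/(_ [::]). Qed.

Lemma smooth_derivable g x v : smooth g -> derivable g x v.
Proof. by case/(_ [::]) => _; apply. Qed.

Lemma smooth_iderive (vs : seq V) g : smooth g -> smooth (iderive vs g).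
Proof.
move=> sg us; rewrite (_ : iderive us _ = iderive (us ++ vs) g) //.
by elim: us => //= u us ->.
Qed.

Lemma smooth_derive g v : smooth g -> smooth ('D_v g).
Proof. exact: (@smooth_iderive [:: v]). Qed.

Lemma iderive_lincomb (I : Type) (r : seq I) (c : I -> R) (G : I -> V -> W)
    (vs : seq V) : (forall i, smooth (G i)) ->
  iderive vs (fun z => \sum_(i <- r) c i *: G i z)
    = (fun z => \sum_(i <- r) c i *: iderive vs (G i) z).
Proof.
move=> sG; elim: vs => [|v vs IH] //=; apply/funext => x; rewrite IH.
have dG i : derivable (iderive vs (G i)) x v by case: (sG i vs).
by have /@derive_val := is_derive_lincomb r c dG.
Qed.

End Derivatives.

Lemma is_derive_monomial (R : realType) (W : normedModType R) (c t : R) n (w : W) :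
  is_derive t 1 (fun s : R => (c * s ^+ n) *: w) ((c * (n%:R * t ^+ n.-1)) *: w).
Proof.
apply: is_derive_scalel.
have -> : (fun s : R => c * s ^+ n) = c \*: ((id : R -> R) ^+ n).
  by apply/funext => s; rewrite /= exprfctE.
have -> : c * (n%:R * t ^+ n.-1) = c *: ((n%:R * id t ^+ n.-1) *: 1).
  by rewrite [_ *: 1]mulr1.
exact: is_deriveZ.
Qed.

(** * Mean value inequality, linearity in the direction, Taylor remainder *)

Section MeanValue.
Local Open Scope classical_set_scope.
Variables (R : realType) (d : nat).

(** The norm is the maximum norm, so the scalar mean value theorem can be used in each coordinate,
    with its own intermediate point, at no cost in the constant. *)
Lemma mean_value_ineq (g g' : R -> 'rV[R]_d) (a b M : R) : a <= b ->
  (forall t, a <= t <= b -> is_derive t 1 g (g' t)) ->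
  (forall t, a < t < b -> `|g' t| <= M) ->
  `|g b - g a| <= M * (b - a).
Proof.
rewrite le_eqVlt => /predU1P[->|ab] dg bg; first by rewrite !subrr normr0 mulr0.
have M0 : 0 <= M.
  by apply: le_trans (normr_ge0 _) (bg ((a + b) / 2) _); apply/andP; split; lra.
apply: norm_le_coord => [|i]; first by rewrite mulr_ge0// subr_ge0 ltW.
have dgi t : a <= t <= b -> is_derive t 1 (fun s => g s 0 i) (g' t 0 i).
  move=> /dg [ex <-]; split; first by move/derivable_mxP: ex; apply.
  by rewrite derive_mx // mxE.
have dgi' t : t \in `]a, b[%R -> is_derive t 1 (fun s => g s 0 i) (g' t 0 i).
  by rewrite in_itv/= => /andP[t1 t2]; apply: dgi; rewrite !ltW.
have cg : {within `[a, b]%classic, continuous (fun s => g s 0 i)}.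
  apply: derivable_within_continuous => t; rewrite in_itv/= => t1.
  by case: (dgi t t1).
have [t tab] := MVT ab dgi' cg; rewrite !mxE => ->.
rewrite normrM (gtr0_norm (_ : 0 < b - a)) ?subr_gt0// ler_wpM2r ?subr_ge0 ?(ltW ab)//.
apply: le_trans (le_coord_norm _ _) _; apply: bg.
by move: tab; rewrite in_itv.
Qed.

(** [smooth] speaks of directional derivatives only, so additivity in the direction needs a proof.
    The increment along v + w is split at x + h v; its second piece is compared with h times
    ['D_w g x] through the mean value inequality and the continuity of ['D_w g]. *)
Lemma derive_addr_dir (V : normedModType R) (g : V -> 'rV[R]_d) x v w :
  smooth g -> 'D_(v + w) g x = 'D_v g x + 'D_w g x.
Proof.
move=> sg; apply: cvg_lim => //.
have E : (fun h : R => h^-1 *: ((g \o shift x) (h *: (v + w)) - g x)) =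
   (fun h : R => h^-1 *: ((g \o shift x) (h *: v) - g x)) +
   (fun h : R => h^-1 *: (g (x + h *: v + h *: w) - g (x + h *: v))).
  apply/funext => h /=; rewrite -[RHS]/(_ *: _ + _ *: _) -scalerDr; congr (_ *: _).
  have -> : h *: (v + w) + x = x + h *: v + h *: w by rewrite scalerDr addrC addrA.
  by rewrite (addrC (h *: v)) [RHS]addrC subrKA.
have dg : derivable g x v by exact: smooth_derivable.
rewrite E; apply: cvgD; first exact: dg.
have cD : continuous ('D_w g) by exact/smooth_continuous/smooth_derive.
apply/cvgrPdist_le => e e0.
have /(@cvgrPdist_le _ _ _ (nbhs x)) := cD x => /(_ _ e0) /nbhs_ballP[r /= r0 re].
near=> h.
have h0 : h != 0 by near: h; exact: nbhs_dnbhs_neq.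
have hr : `|h| * (`|v| + `|w|) < r.
  near: h; have r1 : 0 < r / (`|v| + `|w| + 1).
    by rewrite divr_gt0// ltr_wpDl ?addr_ge0.
  near=> h; have : `|h| < r / (`|v| + `|w| + 1) by near: h; exact: dnbhs0_lt.
  rewrite ltr_pdivlMr ?ltr_wpDl ?addr_ge0//.
  by apply: le_lt_trans; rewrite ler_wpM2l// lerDl.
(* The linear part is subtracted, so [phi'] measures only the variation of ['D_w g] near x. *)
pose phi (s : R) := g (x + h *: v + s *: (h *: w)) - s *: (h *: 'D_w g x).
pose phi' (s : R) := h *: ('D_w g (x + h *: v + s *: (h *: w)) - 'D_w g x).
have dphi (t : R) : 0 <= t <= 1 -> is_derive t 1 phi (phi' t).
  move=> _; rewrite /phi' scalerBr; apply: is_deriveB; last first.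
    by rewrite -[X in is_derive _ _ _ X]scale1r; exact: is_derive_scalel.
  rewrite -derive_scale_dir; last exact: smooth_derivable.
  by apply: is_derive_line; exact: smooth_derivable.
have bphi (t : R) : 0 < t < 1 -> `|phi' t| <= `|h| * e.
  case/andP=> t0 t1; rewrite normrZ ler_wpM2l// distrC; apply: re.
  rewrite -ball_normE /ball_/= -addrA opprD addNKr normrN.
  apply: le_lt_trans hr; apply: le_trans (ler_normD _ _) _.
  rewrite !normrZ mulrDr lerD2l ger0_norm ?(ltW t0)// ler_piMl ?(ltW t1)//.
have := mean_value_ineq ler01 dphi bphi.
rewrite /phi scale1r !scale0r addr0 !subr0 mulr1 scale1r => H.
rewrite -[X in X - _]scale1r -(mulVf h0) -scalerA -scalerBr normrZ normfV.
rewrite ler_pdivrMl ?normr_gt0// distrC; apply: le_trans H.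
by rewrite addrAC.
Unshelve. all: by end_near. Qed.

Lemma derive_lincomb_dir (V : normedModType R) (g : V -> 'rV[R]_d) x
    (I : Type) (r : seq I) (c : I -> R) (v : I -> V) : smooth g ->
  'D_(\sum_(i <- r) c i *: v i) g x = \sum_(i <- r) c i *: 'D_(v i) g x.
Proof.
move=> sg; elim: r => [|i r IH]; first by rewrite !big_nil derive0.
rewrite !big_cons derive_addr_dir// IH derive_scale_dir//.
exact: smooth_derivable.
Qed.

Lemma derive_sub_dir (V : normedModType R) (g : V -> 'rV[R]_d) x v w :
  smooth g -> 'D_(v - w) g x = 'D_v g x - 'D_w g x.
Proof.
move=> sg; rewrite derive_addr_dir// -[- w]scaleN1r derive_scale_dir ?scaleN1r//.
exact: smooth_derivable.
Qed.

(* Integrating the bound M over [0, s] with s <= 1 gives M again, so the induction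
   carries no factorials. *)
Lemma taylor_remainder (G : nat -> R -> 'rV[R]_d) (M : R) (n : nat) :
  (forall k (t : R), is_derive t 1 (G k) (G k.+1 t)) ->
  (forall t, 0 <= t <= 1 -> `|G n t| <= M) ->
  `|G 0%N 1 - \sum_(L < n) (L`!%:R^-1 : R) *: G L 0| <= M.
Proof.
move=> dG bG.
suff H m k s : (k + m)%N = n -> 0 <= s <= 1 ->
    `|G k s - \sum_(L < m) (L`!%:R^-1 * s ^+ L : R) *: G (k + L)%N 0| <= M.
  have := H n 0%N 1 (add0n n) (_ : 0 <= (1 : R) <= 1); rewrite ler01 lexx => /(_ isT).
  by under eq_bigr do rewrite expr1n mulr1.
elim: m k s => [|m IH] k s km s01.
  by rewrite big_ord0 subr0; rewrite addn0 in km; rewrite km bG.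
(* [P] is the remainder of [G k] after m + 1 terms; its derivative is the remainder of [G k.+1]
   after m terms. *)
pose P (t : R) := G k t - \sum_(L < m.+1) (L`!%:R^-1 * t ^+ L : R) *: G (k + L)%N 0.
pose P' (t : R) := G k.+1 t - \sum_(L < m) (L`!%:R^-1 * t ^+ L : R) *: G (k.+1 + L)%N 0.
have dP (t : R) : is_derive t 1 P (P' t).
  apply: is_deriveB.
  have -> : \sum_(L < m) (L`!%:R^-1 * t ^+ L : R) *: G (k.+1 + L)%N 0 =
      \sum_(L < m.+1) (L`!%:R^-1 * (L%:R * t ^+ L.-1) : R) *: G (k + L)%N 0.
    rewrite [RHS]big_ord_recl/= mul0r mulr0 scale0r add0r; apply: eq_bigr => i _.
    rewrite /bump /= add1n addnS addSn mulrA; congr (_ * _ *: _).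
    by rewrite factS natrM invfM mulrAC mulVf ?mul1r// pnatr_eq0.
  by apply: is_derive_bigsum => i; exact: is_derive_monomial.
have s0 : 0 <= s by case/andP: s01.
have P0 : P 0 = 0.
  rewrite /P big_ord_recl/= fact0 invr1 expr0 mulr1 scale1r addn0 big1 ?addr0 ?subrr//.
  by move=> i _; rewrite expr0n mulr0 scale0r.
have M0 : 0 <= M by apply: le_trans (normr_ge0 _) (bG 0 _); rewrite lexx ler01.
have := @mean_value_ineq P P' 0 s M s0 (fun t _ => dP t).
rewrite P0 !subr0 => H; apply: le_trans (H _) _.
  move=> t /andP[t0 t1]; apply: IH; first by rewrite addSnnS.
  by rewrite ltW//= (le_trans (ltW t1))//; case/andP: s01.
by rewrite ler_piMr//; case/andP: s01.
Qed.

End MeanValue.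

(** * Local bounds on iterated derivatives *)

Section LocalBounds.
Local Open Scope classical_set_scope.
Variables (R : realType) (d e : nat).
Implicit Types g : 'rV[R]_d -> 'rV[R]_e.

Lemma derive_coord g x v : smooth g ->
  'D_v g x = \sum_(i < d) v 0 i *: 'D_(delta_mx 0 i) g x.
Proof.
by move=> sg; rewrite [v in LHS]row_sum_delta derive_lincomb_dir.
Qed.

(** Induction on the last direction of the list, the one differentiated first. In the standard basis
    it leaves finitely many functions ['D_(delta_mx 0 i) g], whose neighbourhoods can be
    intersected; the result does not depend on the directions. *)
Lemma iderive_near_bound g (y : 'rV[R]_d) (n : nat) : smooth g ->
  exists2 C, 0 <= C & \forall x \near y, forall vs, size vs = n ->
    `|iderive vs g x| <= C * \prod_(v <- vs) `|v|.
Proof.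
elim: n g => [|n IH] g sg.
  exists (`|g y| + 1); first by rewrite addr_ge0.
  have /(@cvgrPdist_le _ _ _ (nbhs y)) := smooth_continuous sg (x := y).
  move=> /(_ 1 ltr01); apply: filterS => x gx [|//] _.
  rewrite big_nil mulr1 /= -[X in `|X|](subrK (g y)) addrC.
  by apply: le_trans (ler_normD _ _) _; rewrite lerD2l distrC.
have /choice[C HC] : forall i, exists C, 0 <= C /\ \forall x \near y,
    forall vs, size vs = n ->
    `|iderive vs ('D_(delta_mx 0 i) g) x| <= C * \prod_(v <- vs) `|v|.
  by move=> i; have [C C0 H] := IH _ (smooth_derive (delta_mx 0 i) sg); exists C.
exists (\sum_i C i); first by apply: sumr_ge0 => i _; case: (HC i).
have : \forall x \near y, forall i, forall vs, size vs = n ->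
    `|iderive vs ('D_(delta_mx 0 i) g) x| <= C i * \prod_(v <- vs) `|v|.
  apply: (@filter_forall _ _ (fun i x => forall vs, size vs = n ->
    `|iderive vs ('D_(delta_mx 0 i) g) x| <= C i * \prod_(v <- vs) `|v|) _ (nbhs_filter y)) => i.
  by case: (HC i).
apply: filterS => x Hx vs; case/lastP: vs => // vs v; rewrite size_rcons => -[sz].
rewrite iderive_rcons (_ : 'D_v g = fun z => \sum_(i < d) v 0 i *: 'D_(delta_mx 0 i) g z).
  rewrite iderive_lincomb => [|i]; last exact: smooth_derive.
  apply: le_trans (ler_norm_sum _ _ _) _; rewrite mulr_suml; apply: ler_sum => i _.
  rewrite normrZ -cats1 big_cat/= big_seq1 mulrA mulrC.
  by apply: ler_pM => //; [exact: Hx | exact: le_coord_norm].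
by apply/funext => z; exact: derive_coord.
Qed.

Lemma iderive_local_bound g (y : 'rV[R]_d) (n : nat) : smooth g ->
  exists C r, [/\ 0 <= C, 0 < r & forall x vs, `|x - y| < r -> size vs = n ->
    `|iderive vs g x| <= C * \prod_(v <- vs) `|v|].
Proof.
move=> /(iderive_near_bound y n)[C C0 /nbhs_ballP[r /= r0 H]]; exists C, r; split=> //.
by move=> x vs xr; apply: H; rewrite -ball_normE /ball_/= distrC.
Qed.

End LocalBounds.

(** * Calculus of O(h^n) estimates *)

Section BigO.
Variables (R : realType) (X : Type) (hh : X -> R).

(** The index type [X] is arbitrary because the stages are any solution of implicit equations and
    not a function of h. Taking for [X] the pairs (h, k) that satisfy them makes the constants
    uniform over all solutions. *)
Definition bigOh (W : normedModType R) (n : nat) (E : X -> W) : Prop :=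
  exists C h0, [/\ 0 <= C, 0 < h0 & forall x, 0 < hh x < h0 -> `|E x| <= C * hh x ^+ n].

Section Generic.
Variable W : normedModType R.
Implicit Types E F : X -> W.

Lemma bigOh_le (W' : normedModType R) n E (F : X -> W') :
  (forall x, 0 < hh x -> `|E x| <= `|F x|) -> bigOh n F -> bigOh n E.
Proof.
move=> EF [C [h0 [C0 h00 H]]]; exists C, h0; split=> // x /[dup] /andP[x0 _] /H.
exact/le_trans/EF.
Qed.

Lemma bigOh_eq n E F : E =1 F -> bigOh n F -> bigOh n E.
Proof. by move=> EF; apply: bigOh_le => x _; rewrite EF. Qed.

Lemma bigOh_weaken m n E : (m <= n)%N -> bigOh n E -> bigOh m E.
Proof.
move=> mn [C [h0 [C0 h00 H]]]; exists C, (Num.min h0 1); split=> //.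
  by rewrite lt_min h00 ltr01.
move=> x /andP[x0]; rewrite lt_min => /andP[xh x1]; apply: le_trans (H x _) _.
  by rewrite x0.
by rewrite ler_wpM2l// ler_wiXn2l// ltW.
Qed.

Lemma bigOh_cst (w : W) : bigOh 0 (fun=> w).
Proof. by exists `|w|, 1; split=> // x _; rewrite mulr1. Qed.

Lemma bigOh_scale_hh k n E : bigOh n E -> bigOh (k + n) (fun x => hh x ^+ k *: E x).
Proof.
move=> [C [h0 [C0 h00 H]]]; exists C, h0; split=> // x /[dup] /andP[x0 _] /H xE.
rewrite normrZ normrX gtr0_norm// exprD mulrCA ler_wpM2l//.
by rewrite exprn_ge0 ?ltW.
Qed.

Lemma bigOh_add n E F : bigOh n E -> bigOh n F -> bigOh n (fun x => E x + F x).
Proof.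
move=> [C [h0 [C0 h00 H]]] [C' [h0' [C'0 h0'0 H']]].
exists (C + C'), (Num.min h0 h0'); split; rewrite ?addr_ge0 ?lt_min ?h00//.
move=> x; rewrite lt_min => /and3P[x0 xh xh'].
by rewrite (le_trans (ler_normD _ _))// mulrDl lerD ?H ?H' ?x0.
Qed.

Lemma bigOh_scale n (c : R) E : bigOh n E -> bigOh n (fun x => c *: E x).
Proof.
move=> [C [h0 [C0 h00 H]]]; exists (`|c| * C), h0; split=> //; first exact: mulr_ge0.
by move=> x xh; rewrite normrZ -mulrA ler_wpM2l ?H.
Qed.

Lemma bigOh_opp n E : bigOh n E -> bigOh n (fun x => - E x).
Proof. by apply: bigOh_le => x _; rewrite normrN. Qed.

Lemma bigOh_sub n E F : bigOh n E -> bigOh n F -> bigOh n (fun x => E x - F x).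
Proof. by move=> nE nF; apply: bigOh_add => //; exact: bigOh_opp. Qed.

Lemma bigOh_zero n : bigOh n (fun=> 0 : W).
Proof. by exists 0, 1; split=> // x _; rewrite normr0 mul0r. Qed.

Lemma bigOh_sum n (I : Type) (r : seq I) (P : pred I) (E : I -> X -> W) :
  (forall i, P i -> bigOh n (E i)) -> bigOh n (fun x => \sum_(i <- r | P i) E i x).
Proof.
move=> nE; elim: r => [|i r IH].
  by apply: bigOh_eq (bigOh_zero n) => x; rewrite big_nil.
case Pi : (P i); last by apply: bigOh_eq IH => x; rewrite big_cons Pi.
by apply: bigOh_eq (bigOh_add (nE _ Pi) IH) => x; rewrite big_cons Pi.
Qed.

Lemma bigOh_small n E r : bigOh n.+1 E -> 0 < r ->
  exists2 h0, 0 < h0 & forall x, 0 < hh x < h0 -> `|E x| < r.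
Proof.
move=> /(bigOh_weaken (ltn0Sn n))[C [h0 [C0 h00 H]]] r0.
exists (Num.min h0 (r / (C + 1))) => [|x].
  by rewrite lt_min h00 divr_gt0// ltr_wpDl.
rewrite lt_min => /and3P[x0 xh xr]; apply: le_lt_trans (H x _) _; first by rewrite x0.
move: xr; rewrite ltr_pdivlMr ?ltr_wpDl// mulrC expr1; apply: le_lt_trans.
by rewrite ler_wpM2r ?(ltW x0)// lerDl.
Qed.

End Generic.

(** Once h M is at most 1/2, the last term is absorbed on the left at the price of a factor 2; an
    implicit equation thus yields a bound. *)
Lemma bigOh_absorb n (u E : X -> R) (M : R) : 0 <= M -> (forall x, 0 <= u x) ->
  (forall x, 0 < hh x -> u x <= E x + hh x * (M * u x)) ->
  bigOh n (E : X -> R^o) -> bigOh n (u : X -> R^o).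
Proof.
move=> M0 u0 Hu [C [h0 [C0 h00 H]]].
exists (C * 2), (Num.min h0 (2 * (M + 1))^-1); split; first by rewrite mulr_ge0.
  by rewrite lt_min h00 invr_gt0 mulr_gt0// ltr_wpDl.
move=> x; rewrite lt_min => /and3P[x0 xh xM]; have := H x; rewrite x0 xh => /(_ isT).
move=> /(le_trans (ler_norm _)) Ex; rewrite [`|_|]ger0_norm//.
have xMu : hh x * (M * u x) <= u x / 2.
  rewrite mulrA mulrC ler_wpM2l//.
  have : hh x * (2 * (M + 1)) <= 1.
    by rewrite -ler_pdivlMr ?div1r ?(ltW xM)// mulr_gt0// ltr_wpDl.
  nra.
have := Hu _ x0; lra.
Qed.

Section Smooth.
Variables (d e : nat) (g : 'rV[R]_d -> 'rV[R]_e) (y : 'rV[R]_d).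
Hypothesis sg : smooth g.
Implicit Types u w : X -> 'rV[R]_d.

Lemma bigOh_bounded u n : bigOh n.+1 u -> bigOh 0 (fun x => g (y + u x)).
Proof.
have [C [r [C0 r0 H]]] := iderive_local_bound y 0 sg.
move=> /bigOh_small /(_ r0)[h0 h00 Hh]; exists C, h0; split=> // x /Hh ux.
by have := H (y + u x) [::]; rewrite addrAC subrr add0r big_nil; apply.
Qed.

Lemma bigOh_derive n u : bigOh n u -> bigOh n (fun x => 'D_(u x) g y).
Proof.
have [C [r [C0 r0 H]]] := iderive_local_bound y 1 sg.
have Hy v : `|'D_v g y| <= C * `|v|.
  by have := H y [:: v]; rewrite subrr normr0 big_seq1; apply.
move=> [C' [h0 [C'0 h00 Hu]]]; exists (C * C'), h0; split=> //; first exact: mulr_ge0.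
by move=> x /Hu ux; rewrite (le_trans (Hy _))// -mulrA ler_wpM2l.
Qed.

(** For small h both w and u - w are shorter than r / 2, so the segment from y + w to y + u stays in
    the ball where the first derivative is bounded. *)
Lemma bigOh_lipschitz n u w : bigOh 1 w -> bigOh n.+1 (fun x => u x - w x) ->
  bigOh n.+1 (fun x => g (y + u x) - g (y + w x)).
Proof.
have [C [r [C0 r0 H]]] := iderive_local_bound y 1 sg.
have r2 : 0 < r / 2 by rewrite divr_gt0.
move=> w1 uw; have [h1 h10 H1] := bigOh_small w1 r2.
have [h2 h20 H2] := bigOh_small uw r2.
have [C' [h0 [C'0 h00 Hu]]] := uw.
exists (C * C'), (Num.min h0 (Num.min h1 h2)); split; rewrite ?mulr_ge0 ?lt_min ?h00 ?h10//.
move=> x; rewrite !lt_min => /and4P[x0 xh0 xh1 xh2].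
have := Hu x; rewrite x0 xh0 => /(_ isT) ux; rewrite -mulrA.
apply: le_trans (_ : C * `|u x - w x| <= _); last by rewrite ler_wpM2l.
pose p (s : R) := g (y + w x + s *: (u x - w x)).
pose p' (s : R) := 'D_(u x - w x) g (y + w x + s *: (u x - w x)).
have dp (t : R) : 0 <= t <= 1 -> is_derive t 1 p (p' t).
  by move=> _; apply: is_derive_line; exact: smooth_derivable.
have := @mean_value_ineq R e p p' 0 1 (C * `|u x - w x|) ler01 dp.
rewrite /p scale1r scale0r addr0 subr0 mulr1 -addrA [w x + _]addrC subrK; apply.
move=> t /andP[t0 t1]; have := H (y + w x + t *: (u x - w x)) [:: u x - w x].
rewrite big_seq1; apply=> //; rewrite [X in `|X|]addrC !addrA addNr add0r [r]splitr.
apply: le_lt_trans (ler_normD _ _) _; rewrite ltr_leD ?H1 ?x0//.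
rewrite normrZ gtr0_norm// ltW//; apply: le_lt_trans (H2 x _); last by rewrite x0.
by rewrite ler_piMl// ltW.
Qed.

Lemma bigOh_taylor n w : bigOh 1 w ->
  bigOh n (fun x => g (y + w x) -
    \sum_(L < n) (L`!%:R^-1 : R) *: iderive (nseq L (w x)) g y).
Proof.
have [C [r [C0 r0 H]]] := iderive_local_bound y n sg.
move=> w1; have [h1 h10 H1] := bigOh_small w1 r0.
have [C' [h0 [C'0 h00 Hw]]] := w1.
exists (C * C' ^+ n), (Num.min h0 h1).
split; rewrite ?mulr_ge0 ?exprn_ge0 ?lt_min ?h00//.
move=> x; rewrite !lt_min => /and3P[x0 xh0 xh1].
have {Hw} := Hw x; rewrite x0 xh0 => /(_ isT) wx.
apply: le_trans (_ : C * `|w x| ^+ n <= _); last first.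
  rewrite expr1 in wx; rewrite -mulrA -exprMn ler_wpM2l//.
  by apply: lerXn2r => //; rewrite nnegrE// mulr_ge0// ltW.
(* These are the successive derivatives of s |-> g (y + s w), to which [taylor_remainder]
   applies. *)
pose G L (s : R) := iderive (nseq L (w x)) g (y + s *: w x).
have dG k (t : R) : is_derive t 1 (G k) (G k.+1 t).
  by apply: is_derive_line; exact/smooth_derivable/smooth_iderive.
have := @taylor_remainder R e G (C * `|w x| ^+ n) n dG.
rewrite /G /= scale1r scale0r addr0; apply=> t /andP[t0 t1].
have := H (y + t *: w x) (nseq n (w x)).
rewrite big_nseq size_nseq [y + t *: _ - y]addrAC subrr add0r.
have -> : iter n ( *%R `|w x|) 1 = `|w x| ^+ n by elim: (n) => //= m ->; rewrite exprS.
apply=> //; apply: le_lt_trans (H1 x _); last by rewrite x0.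
by rewrite normrZ ger0_norm// ler_piMl.
Qed.

End Smooth.
End BigO.

(** * Expansion over ordered trees *)

Fixpoint tups (T : Type) (L : nat) (S : seq T) : seq (seq T) :=
  if L is L'.+1 then [seq t :: ts | t <- S, ts <- tups L' S] else [:: [::]].

Lemma eq_big_tups (T : Type) (V : nmodType) L (S : seq T) (G H : seq T -> V) :
  (forall ts, size ts = L -> G ts = H ts) ->
  \sum_(ts <- tups L S) G ts = \sum_(ts <- tups L S) H ts.
Proof.
elim: L G H => [|L IH] G H GH /=; first by rewrite !big_seq1 GH.
rewrite !big_allpairs_dep; apply: eq_bigr => t _.
by apply: IH => ts sz; apply: GH; rewrite /= sz.
Qed.

Lemma big_tups1 (T : Type) (V : nmodType) (S : seq T) (G : seq T -> V) :
  \sum_(ts <- tups 1 S) G ts = \sum_(t <- S) G [:: t].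
Proof. by rewrite big_allpairs_dep; apply: eq_bigr => t _; rewrite big_seq1. Qed.

(** Each of the L equal directions is expanded on its own, so the sum runs over ordered L-tuples and
    no multinomial coefficient appears. *)
Lemma iderive_nseq_lincomb (R : realType) (V : normedModType R) d
    (g : V -> 'rV[R]_d) (T : Type) (S : seq T) (c : T -> R) (v : T -> V) L :
  smooth g ->
  iderive (nseq L (\sum_(t <- S) c t *: v t)) g =
  (fun z => \sum_(ts <- tups L S) (\prod_(t <- ts) c t) *: iderive (map v ts) g z).
Proof.
move=> sg; elim: L => [|L IH] /=; apply/funext => z.
  by rewrite big_seq1 big_nil scale1r.
rewrite IH big_allpairs_dep/= exchange_big/=.
rewrite (_ : 'D__ _ z = \sum_(ts <- tups L S) (\prod_(t <- ts) c t) *: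
    'D_(\sum_(t <- S) c t *: v t) (iderive (map v ts) g) z).
  apply: eq_bigr => ts _; rewrite derive_lincomb_dir; last exact: smooth_iderive.
  rewrite scaler_sumr; apply: eq_bigr => t _.
  by rewrite big_cons scalerA mulrC.
apply: derive_val; apply: is_derive_lincomb => ts.
exact/smooth_derivable/smooth_iderive.
Qed.

Lemma bigOh_compose (R : realType) (X : Type) (hh : X -> R) d e
    (g : 'rV[R]_d -> 'rV[R]_e) (y : 'rV[R]_d) (u : X -> 'rV[R]_d)
    (T : Type) (S : seq T) (a : T -> R) (r : T -> nat) (v : T -> 'rV[R]_d) n :
  smooth g -> (forall t, (0 < r t)%N) ->
  bigOh hh n.+1 (fun x => u x - \sum_(t <- S) (a t * hh x ^+ r t) *: v t) ->
  bigOh hh n.+1 (fun x => g (y + u x) - \sum_(L < n.+2) \sum_(ts <- tups L S)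
    (L`!%:R^-1 * \prod_(t <- ts) (a t * hh x ^+ r t)) *: iderive (map v ts) g y).
Proof.
move=> sg r0 Hu; pose w x := \sum_(t <- S) (a t * hh x ^+ r t) *: v t.
have w1 : bigOh hh 1 w.
  apply: bigOh_sum => t _; apply: bigOh_weaken (r0 t) _; rewrite -[r t]addn0.
  apply: bigOh_eq (bigOh_scale_hh (r t) (bigOh_cst hh (a t *: v t))) => x.
  by rewrite addn0 scalerA mulrC.
have H1 := bigOh_lipschitz y sg w1 Hu.
(* One Taylor term more than the order asks for: the layer L = 1 is then present even for n = 0, as
   the later matching of the Jacobian term with one-child trees assumes. *)
have H2 := bigOh_weaken (leqnSn n.+1) (bigOh_taylor y sg n.+2 w1).
apply: bigOh_eq (bigOh_add H1 H2) => x; rewrite subrKA; congr (_ - _).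
apply: eq_bigr => L _; rewrite iderive_nseq_lincomb// scaler_sumr.
by apply: eq_bigr => ts _; rewrite scalerA.
Qed.

Section Trees.
Variable N : nat.
Implicit Types t : ctree N.

Definition graft (n : nat) (S : seq (ctree N)) : seq (ctree N) :=
  [seq CNode m ch | m <- enum 'I_N, ch <- flatten [seq tups L S | L <- iota 0 n]].

(* Every tree with at most n vertices occurs in trees n; the larger ones that occur too
   only contribute terms of order h^(n+1). *)
Fixpoint trees (n : nat) : seq (ctree N) :=
  if n is n'.+1 then graft n'.+2 (trees n') else [::].

Lemma big_trees (V : nmodType) n (G : ctree N -> V) :
  \sum_(t <- trees n.+1) G t =
  \sum_(m < N) \sum_(L < n.+2) \sum_(ch <- tups L (trees n)) G (CNode m ch).
Proof.
rewrite -[trees n.+1]/(graft n.+2 (trees n)) big_allpairs_dep big_enum; apply: eq_bigr => m _.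
rewrite big_flatten big_map -(big_mkord xpredT
  (fun L => \sum_(ch <- tups L (trees n)) G (CNode m ch))).
by rewrite /index_iota subn0.
Qed.

Lemma rho_gt0 t : (0 < rho t)%N.
Proof. by case: t. Qed.

Lemma tdensE m (ch : seq (ctree N)) :
  tdens (CNode m ch) = (rho (CNode m ch) * \prod_(t <- ch) tdens t)%N.
Proof. by rewrite -(big_map _ xpredT id) -foldrE. Qed.

Lemma rhoE m (ch : seq (ctree N)) : rho (CNode m ch) = (\sum_(t <- ch) rho t).+1.
Proof. by rewrite /= sumnE big_map. Qed.

Lemma expr_rho (R : comNzRingType) (h : R) m (ch : seq (ctree N)) :
  h ^+ rho (CNode m ch) = h * \prod_(t <- ch) h ^+ rho t.
Proof. by rewrite rhoE exprS -expr_sum. Qed.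

Section Weights.
Variable R : fieldType.

(* Children are ordered, so an unordered tree occurs several times in the expansion;
   the Taylor factors 1/L! at all vertices account for the multiplicity. *)
Fixpoint wt t : R :=
  let: CNode _ ch := t in (size ch)`!%:R^-1 * foldr *%R 1 (map wt ch).

Lemma wtE m ch : wt (CNode m ch) = (size ch)`!%:R^-1 * \prod_(t <- ch) wt t.
Proof. by rewrite -[in RHS](big_map _ xpredT id) -foldrE. Qed.
End Weights.
End Trees.

Section ElementaryDifferentials.
Variables (R : realType) (N d : nat) (f : 'I_N -> 'rV[R]_d -> 'rV[R]_d) (y0 : 'rV[R]_d).

Fixpoint eldiff (t : ctree N) : 'rV[R]_d :=
  let: CNode m ch := t in iderive (map eldiff ch) (f m) y0.

Hypothesis sf : forall m, smooth (f m).

Section Stages.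
Variables (s : 'I_N -> nat) (alpha gamma : forall q m : 'I_N, 'M[R]_(s q, s m)).
Variables (X : Type) (hh : X -> R) (k : X -> forall q : 'I_N, 'I_(s q) -> 'rV[R]_d).
Arguments k : clear implicits.
Hypothesis Hk : forall x, stage_eqs alpha gamma f y0 (hh x) (k x).

(* The stages with a common index are coupled through the Jacobian term; for small h this
   coupling is a contraction, hence the induction on the index. *)
Lemma stage_bigOh1 q i : bigOh hh 1 (fun x => k x q i).
Proof.
suff H n q' (i' : 'I_(s q')) : (i' < n)%N -> bigOh hh 1 (fun x => k x q' i').
  exact: (H (s q)).
elim: n q' i' {q i} => // n IH.
have /choice[c Hc] : forall q, exists c, 0 <= c /\ forall v, `|'D_v (f q) y0| <= c * `|v|.
  move=> q; have [C [r [C0 r0 H]]] := iderive_local_bound y0 1 (sf q).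
  exists C; split=> // v; have := H y0 [:: v].
  by rewrite subrr normr0 big_seq1; apply.
(* Only the part [G2] of the Jacobian argument involves stages of the current index n; [E] is what
   remains and is controlled by stages of smaller index. *)
pose G2 x q (i : 'I_(s q)) := \sum_(m < N) \sum_(j < s m | j == n :> nat) gamma q m i j *: k x m j.
pose E x q i := k x q i - hh x *: 'D_(G2 x q i) (f q) y0.
have EO q (i : 'I_(s q)) : i = n :> nat -> bigOh hh 1 (fun x => E x q i).
  move=> iN.
  pose A x := \sum_(m < N) \sum_(j < s m | (j < i)%N) alpha q m i j *: k x m j.
  pose G1 x := \sum_(m < N) \sum_(j < s m | (j < i)%N) gamma q m i j *: k x m j.
  have AO : bigOh hh 1 A.
    apply: bigOh_sum => m _; apply: bigOh_sum => j ji; apply: bigOh_scale.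
    by apply: IH; rewrite -iN.
  have G1O : bigOh hh 0 G1.
    apply: bigOh_weaken (leqnSn 0) _.
    apply: bigOh_sum => m _; apply: bigOh_sum => j ji; apply: bigOh_scale.
    by apply: IH; rewrite -iN.
  have := bigOh_scale_hh 1 (bigOh_add (bigOh_bounded y0 (sf q) AO) (bigOh_derive y0 (sf q) G1O)).
  apply: bigOh_eq => x; rewrite /E Hk expr1 scalerDr -addrA; congr (_ + _).
  rewrite -scalerBr; congr (_ *: _); apply/eqP; rewrite subr_eq; apply/eqP.
  rewrite /jac -derive_addr_dir//; congr ('D_ _ (f q) y0).
  rewrite /G1 /G2 -big_split/=; apply: eq_bigr => m _.
  rewrite (bigID (fun j : 'I_(s m) => (j < i)%N))/=; congr (_ + _); apply: eq_bigl => j.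
    by case: ltngtP.
  by rewrite -iN; case: ltngtP.
(* The stages of index n are coupled across all q, so their norms are bounded together. *)
pose u x : R := \sum_(q < N) \sum_(i < s q | i == n :> nat) `|k x q i|.
pose g q (i : 'I_(s q)) := \sum_(m < N) \sum_(j < s m) `|gamma q m i j|.
pose M := \sum_(q < N) \sum_(i < s q | i == n :> nat) (c q * g q i).
have ku x m (j : 'I_(s m)) : j = n :> nat -> `|k x m j| <= u x.
  move=> jn; rewrite /u (bigD1 m)//= (bigD1 j) ?jn//= -addrA lerDl.
  by rewrite addr_ge0// ?sumr_ge0// => ? _; rewrite sumr_ge0.
have u0 x : 0 <= u x by apply: sumr_ge0 => ? _; apply: sumr_ge0.
have g0 q i : 0 <= g q i by apply: sumr_ge0 => ? _; apply: sumr_ge0.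
have M0 : 0 <= M.
  apply: sumr_ge0 => q _; apply: sumr_ge0 => i _; apply: mulr_ge0 => //.
  by case: (Hc q).
have uO : bigOh hh 1 (u : X -> R^o).
  apply: (@bigOh_absorb R X hh 1 u
    (fun x => \sum_(q < N) \sum_(i < s q | i == n :> nat) `|E x q i|) M) => //.
    move=> x x0; rewrite {1}/u /M mulr_suml mulr_sumr -big_split/=; apply: ler_sum => q _.
    rewrite mulr_suml mulr_sumr -big_split/=; apply: ler_sum => i /eqP iN.
    rewrite -[X in `|X|](subrK (hh x *: 'D_(G2 x q i) (f q) y0)).
    apply: le_trans (ler_normD _ _) _; rewrite lerD2l normrZ gtr0_norm// ler_wpM2l ?(ltW x0)//.
    apply: le_trans (proj2 (Hc q) _) _; rewrite -mulrA ler_wpM2l ?(proj1 (Hc q))//.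
    rewrite /g mulr_suml (le_trans (ler_norm_sum _ _ _))//; apply: ler_sum => m _.
    rewrite mulr_suml (le_trans (ler_norm_sum _ _ _))//.
    rewrite big_mkcond; apply: ler_sum => j _; case: eqP => jn; last by rewrite mulr_ge0.
    by rewrite normrZ ler_wpM2l// ku.
  apply: bigOh_sum => q _; apply: bigOh_sum => i /eqP iN.
  by apply: bigOh_le (EO q i iN) => x _; rewrite normr_id.
move=> q i; rewrite ltnS leq_eqVlt => /predU1P[iN|]; last exact: IH.
by apply: bigOh_le uO => x _; rewrite [leRHS]ger0_norm ?ku.
Qed.

End Stages.
End ElementaryDifferentials.

Section ThetaE.
Variables (R : realType) (N : nat) (s : 'I_N -> nat).
Variables (alpha beta : forall q m : 'I_N, 'M[R]_(s q, s m)).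
Local Notation th := (theta alpha beta).

Lemma theta_neq m q ch i : m != q -> th (CNode m ch) q i 0 = 0.
Proof. by move=> mq; rewrite /= (negbTE mq) mxE. Qed.

Lemma mulmx_sum_coord (a : forall q m : 'I_N, 'M[R]_(s q, s m)) q
    (v : forall m, 'cV[R]_(s m)) i :
  (\sum_(m < N) a q m *m v m) i 0 = \sum_(m < N) \sum_(j < s m) a q m i j * v m j 0.
Proof. by rewrite summxE; apply: eq_bigr => m _; rewrite mxE. Qed.

(** The empty product covers the single vertex, which leaves one child as the only exceptional
    case. *)
Lemma theta_node q ch i :
  th (CNode q ch) q i 0 =
  if ch is [:: t] then \sum_(m < N) \sum_(j < s m) beta q m i j * th t m j 0
  else \prod_(t <- ch) \sum_(m < N) \sum_(j < s m) alpha q m i j * th t m j 0.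
Proof.
case: ch => [|t [|t' ch]]; rewrite /= eqxx.
- by rewrite mxE big_nil.
- exact: mulmx_sum_coord.
- rewrite mxE -!map_cons big_map; apply: eq_bigr => u _; exact: mulmx_sum_coord.
Qed.
End ThetaE.

(** * Expansion of the stages *)

Section StageExpansion.
Variables (R : realType) (N d : nat) (f : 'I_N -> 'rV[R]_d -> 'rV[R]_d) (y0 : 'rV[R]_d).
Hypothesis sf : forall m, smooth (f m).
Variables (s : 'I_N -> nat) (alpha gamma : forall q m : 'I_N, 'M[R]_(s q, s m)).
Hypothesis Halpha :
  forall q m (i : 'I_(s q)) (j : 'I_(s m)), (i <= j)%N -> alpha q m i j = 0.
Hypothesis Hgamma :
  forall q m (i : 'I_(s q)) (j : 'I_(s m)), (i < j)%N -> gamma q m i j = 0.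

Let th (t : ctree N) q (i : 'I_(s q)) : R :=
  theta alpha (fun q m => alpha q m + gamma q m) t q i 0.

Lemma stage_sum_alpha (k : forall q : 'I_N, 'I_(s q) -> 'rV[R]_d) q (i : 'I_(s q)) :
  \sum_(m < N) \sum_(j < s m | (j < i)%N) alpha q m i j *: k m j =
  \sum_(m < N) \sum_(j < s m) alpha q m i j *: k m j.
Proof.
apply: eq_bigr => m _; rewrite big_mkcond; apply: eq_bigr => j _.
by case: ltnP => // ij; rewrite Halpha// scale0r.
Qed.

Lemma stage_sum_gamma (k : forall q : 'I_N, 'I_(s q) -> 'rV[R]_d) q (i : 'I_(s q)) :
  \sum_(m < N) \sum_(j < s m | (j <= i)%N) gamma q m i j *: k m j =
  \sum_(m < N) \sum_(j < s m) gamma q m i j *: k m j.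
Proof.
apply: eq_bigr => m _; rewrite big_mkcond; apply: eq_bigr => j _.
by case: leqP => // ij; rewrite Hgamma// scale0r.
Qed.

(** Coefficient of h^rho(t) F(t) in the expansion of the sum of [a q m i j *: k m j] over m and
    j. *)
Let coef (a : forall q m : 'I_N, 'M[R]_(s q, s m)) q (i : 'I_(s q)) (t : ctree N) : R :=
  wt R t * \sum_(m < N) \sum_(j < s m) a q m i j * th t j.

(** Contribution of the Jacobian: being linear in its direction, it produces only trees whose root
    has one child. *)
Let jac_term h q (i : 'I_(s q)) (ch : seq (ctree N)) : R :=
  if ch is [:: t] then coef gamma i t * h ^+ rho t else 0.

(** With one child the two contributions add up to alpha + gamma, the matrix used by theta there;
    otherwise only the product with alpha remains. The leading h accounts for the root. *)
Lemma stage_coef h q (i : 'I_(s q)) ch :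
  wt R (CNode q ch) * th (CNode q ch) i * h ^+ rho (CNode q ch) =
  h * ((size ch)`!%:R^-1 * \prod_(t <- ch) (coef alpha i t * h ^+ rho t)
       + jac_term h i ch).
Proof.
rewrite expr_rho wtE /th theta_node /coef; case: ch => [|t [|t' ch]] /=.
- by rewrite !big_nil; ring.
- rewrite !big_seq1 invr1; set A := (X in _ = _ * (_ * (_ * X * _) + _)).
  rewrite /coef; set B := (X in _ = _ * (_ + _ * X * _)).
  set D := (X in _ * X * _ = _); suff -> : D = A + B by ring.
  rewrite /A /B -big_split; apply: eq_bigr => m _; rewrite -big_split.
  by apply: eq_bigr => j _; rewrite mxE mulrDl.
- by rewrite !big_split/=; ring.
Qed.

(** The two inner sums are what the Taylor formula of f_q and its Jacobian make of the expansion
    over [trees N n]. *)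
Lemma stage_sum_trees h n q (i : 'I_(s q)) :
  \sum_(t <- trees N n.+1) (wt R t * th t i * h ^+ rho t) *: eldiff f y0 t =
  h *: (\sum_(L < n.+2) \sum_(ch <- tups L (trees N n))
          (L`!%:R^-1 * \prod_(t <- ch) (coef alpha i t * h ^+ rho t))
             *: iderive (map (eldiff f y0) ch) (f q) y0
        + \sum_(t <- trees N n) (coef gamma i t * h ^+ rho t) *: 'D_(eldiff f y0 t) (f q) y0).
Proof.
rewrite big_trees (bigD1 q)//= [X in _ + X]big1 ?addr0; last first.
  move=> m mq; rewrite big1// => L _; rewrite big1// => ch _.
  by rewrite /th theta_neq// mulr0 mul0r scale0r.
(* The Jacobian sum becomes the layer L = 1 of a sum over all layers. *)
have -> : \sum_(t <- trees N n) (coef gamma i t * h ^+ rho t) *: 'D_(eldiff f y0 t) (f q) y0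
    = \sum_(L < n.+2) \sum_(ch <- tups L (trees N n))
        jac_term h i ch *: iderive (map (eldiff f y0) ch) (f q) y0.
  rewrite 2!big_ord_recl big_seq1 scale0r add0r big_tups1.
  rewrite [X in _ = _ + X]big1 ?addr0//.
  move=> L _; rewrite (@eq_big_tups _ _ _ _ _ (fun=> 0)) ?big1//.
  by case=> [|t [|t' ch]]//= _; rewrite scale0r.
rewrite -big_split scaler_sumr; apply: eq_bigr => L _.
rewrite -big_split scaler_sumr; apply: eq_big_tups => ch chL /=.
by rewrite stage_coef chL -scalerDl scalerA.
Qed.

Variables (X : Type) (hh : X -> R) (k : X -> forall q : 'I_N, 'I_(s q) -> 'rV[R]_d).
Arguments k : clear implicits.
Hypothesis Hk : forall x, stage_eqs alpha gamma f y0 (hh x) (k x).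

(** Each pass through the stage equations multiplies by h, which turns an error O(h^(n+1)) in the
    arguments into O(h^(n+2)). *)
Lemma stage_expansion n q (i : 'I_(s q)) :
  bigOh hh n.+1 (fun x => k x q i -
    \sum_(t <- trees N n) (wt R t * th t i * hh x ^+ rho t) *: eldiff f y0 t).
Proof.
elim: n q i => [|n IH] q i.
  apply: bigOh_eq (stage_bigOh1 sf Hk i) => x.
  by rewrite big_nil subr0.
(* Used with [alpha] for the argument of f_q and with [gamma] for the Jacobian direction. *)
have lin (a : forall q m : 'I_N, 'M[R]_(s q, s m)) :
    bigOh hh n.+1 (fun x => \sum_(m < N) \sum_(j < s m) a q m i j *: k x m j -
      \sum_(t <- trees N n) (coef a i t * hh x ^+ rho t) *: eldiff f y0 t).
  have : bigOh hh n.+1 (fun x => \sum_(m < N) \sum_(j < s m) a q m i j *: (k x m j -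
      \sum_(t <- trees N n) (wt R t * th t j * hh x ^+ rho t) *: eldiff f y0 t)).
    by apply: bigOh_sum => m _; apply: bigOh_sum => j _; exact: bigOh_scale.
  apply: bigOh_eq => x; apply/esym.
  under eq_bigr do under eq_bigr do rewrite scalerBr.
  under eq_bigr do rewrite sumrB.
  rewrite sumrB; congr (_ - _).
  under eq_bigr do under eq_bigr do rewrite scaler_sumr.
  under eq_bigr do rewrite exchange_big/=.
  rewrite exchange_big/=; apply: eq_bigr => t _.
  rewrite /coef mulr_sumr mulr_suml scaler_suml; apply: eq_bigr => m _.
  rewrite mulr_sumr mulr_suml scaler_suml; apply: eq_bigr => j _.
  by rewrite scalerA; congr (_ *: _); ring.
have H1 := bigOh_compose y0 (sf q) (@rho_gt0 N) (lin alpha).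
have H2 := bigOh_derive y0 (sf q) (lin gamma).
apply: bigOh_eq (bigOh_scale_hh 1 (bigOh_add H1 H2)) => x.
rewrite expr1 stage_sum_trees Hk /jac stage_sum_alpha stage_sum_gamma -scalerDr -scalerBr.
congr (_ *: _); rewrite derive_sub_dir// derive_lincomb_dir//.
by rewrite opprD addrACA.
Qed.

End StageExpansion.

(** * Expansion of the exact solution *)

Section ExactSolution.
Local Open Scope classical_set_scope.
Variables (R : realType) (N d : nat) (f : 'I_N -> 'rV[R]_d -> 'rV[R]_d).
Variables (y : R -> 'rV[R]_d) (T : R).
Hypothesis sf : forall m, smooth (f m).
Hypothesis T0 : 0 < T.
Hypothesis Hy : forall t : R, - T < t < T -> is_derive t 1 y (\sum_(m < N) f m (y t)).

(** The error [E] of the expansion at level n + 1 has as derivative the error [E'] of inserting the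
    expansion at level n into the fields; integration gains one power of h. *)
Lemma exact_expansion n :
  bigOh id n.+1 (fun h => y h - y 0 -
    \sum_(t <- trees N n) (wt R t / (tdens t)%:R * h ^+ rho t) *: eldiff f (y 0) t).
Proof.
elim: n => [|n IH].
  suff : bigOh id 1 (fun h => y h - y 0).
    by apply: bigOh_eq => h; rewrite big_nil subr0.
  have : derivable y 0 1 by case: (Hy (t := 0)); rewrite // oppr_lt0 T0.
  (* Near 0 the difference quotient is within 1 of the derivative, whence the constant below. *)
  rewrite /derivable => /cvgrPdist_le /(_ 1 ltr01).
  case=> r /= r0 Hr; exists (`|'D_1 y 0| + 1), r; split; rewrite ?addr_ge0//.
  move=> h /andP[h0 hr]; have := Hr h; rewrite /= sub0r normrN gtr0_norm//.
  rewrite gt_eqF// addr0 [h *: 1]mulr1 => /(_ hr isT) H.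
  rewrite expr1 -ler_pdivrMr// mulrC -[X in X * _]gtr0_norm ?invr_gt0// -normrZ.
  rewrite -lerBlDl; apply: le_trans H; rewrite distrC; exact: lerB_dist.
pose c (t : ctree N) : R := wt R t / (tdens t)%:R.
pose E h := y h - y 0 - \sum_(t <- trees N n.+1) (c t * h ^+ rho t) *: eldiff f (y 0) t.
pose E' h := \sum_(m < N) (f m (y 0 + (y h - y 0)) -
  \sum_(L < n.+2) \sum_(ts <- tups L (trees N n))
    (L`!%:R^-1 * \prod_(t <- ts) (c t * h ^+ rho t)) *:
       iderive (map (eldiff f (y 0)) ts) (f m) (y 0)).
have [C [h0 [C0 h00 HE']]] : bigOh id n.+1 E'.
  apply: bigOh_sum => m _.
  exact: (@bigOh_compose R R id d d (f m) (y 0) (fun h => y h - y 0) _ (trees N n) c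
    (@rho N) (eldiff f (y 0)) n (sf m) (@rho_gt0 N) IH).
have dE (h : R) : - T < h < T -> is_derive h 1 E (E' h).
  move=> hT; rewrite /E' sumrB; apply: is_deriveB; last first.
    (* Differentiation brings down rho(t), which cancels the leading factor of [tdens] and leaves a
       product over the children. *)
    rewrite (_ : \sum_(m < N) _ =
        \sum_(t <- trees N n.+1) (c t * ((rho t)%:R * h ^+ (rho t).-1)) *: eldiff f (y 0) t).
      by apply: is_derive_bigsum => t; exact: is_derive_monomial.
    rewrite big_trees; apply: eq_bigr => m _; apply: eq_bigr => L _.
    apply: eq_big_tups => ch chL; congr (_ *: _).
    rewrite /c wtE tdensE chL rhoE/= natrM invfM natr_prod -prodfV.
    rewrite expr_sum !big_split/=.
    rewrite -!mulrA; do 2![congr (_ * _)]; rewrite [RHS]mulrCA; congr (_ * _).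
    by rewrite mulrA mulVf ?mul1r ?pnatr_eq0.
  under eq_bigr do rewrite addrC subrK.
  have := Hy hT => dy; rewrite -[X in is_derive _ _ _ X]subr0.
  apply: is_deriveB; exact: is_derive_cst.
have E0 : E 0 = 0.
  rewrite /E subrr big1 ?subrr// => t _.
  by rewrite expr0n eqn0Ngt rho_gt0 mulr0 scale0r.
exists C, (Num.min h0 T); split; rewrite ?lt_min ?h00//.
move=> h; rewrite lt_min => /and3P[h_gt0 hh0 hT].
rewrite exprS mulrCA mulrC.
have := @mean_value_ineq R d E E' 0 h (C * h ^+ n.+1) (ltW h_gt0).
rewrite E0 !subr0; apply.
  move=> t /andP[t0 th]; apply: dE; rewrite (le_lt_trans th hT) andbT.
  by rewrite (lt_le_trans _ t0)// oppr_lt0.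
move=> t /andP[t0 th]; apply: le_trans (HE' t _) _.
  by rewrite t0 (lt_trans th).
by rewrite ler_wpM2l// lerXn2r ?nnegrE ?ltW.
Qed.

End ExactSolution.

(** * Sufficiency of the order conditions *)

Lemma order_conditions_sufficient (R : realType) (N : nat) (s : 'I_N -> nat)
  (b : forall q : 'I_N, 'cV[R]_(s q))
  (alpha gamma : forall q m : 'I_N, 'M[R]_(s q, s m))
  (Halpha : forall q m (i : 'I_(s q)) (j : 'I_(s m)), (i <= j)%N -> alpha q m i j = 0)
  (Hgamma : forall q m (i : 'I_(s q)) (j : 'I_(s m)), (i < j)%N -> gamma q m i j = 0)
  (p : nat) :
  (forall t : ctree N, (1 <= rho t <= p)%N ->
     \sum_(m < N) \sum_(i < s m) b m i 0 *
        theta alpha (fun q m => alpha q m + gamma q m) t m i 0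
     = (tdens t)%:R^-1) ->
  has_order b alpha gamma p.
Proof.
move=> Hoc d f sf y0 y T T0 yy0 Hy.
pose X := {hk : R * (forall q : 'I_N, 'I_(s q) -> 'rV[R]_d) |
  stage_eqs alpha gamma f y0 hk.1 hk.2}.
pose hh (x : X) := (sval x).1.
pose th (t : ctree N) q i := theta alpha (fun q m => alpha q m + gamma q m) t q i 0.
pose F := eldiff f y0.
have Hk (x : X) : stage_eqs alpha gamma f y0 (hh x) (sval x).2 by exact: (svalP x).
have num := stage_expansion sf Halpha Hgamma Hk p.
have ex : bigOh hh p.+1 (fun x => y (hh x) - y0 -
    \sum_(t <- trees N p) (wt R t / (tdens t)%:R * hh x ^+ rho t) *: F t).
  have [C [h0 [C0 h00 H]]] := exact_expansion sf T0 Hy p.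
  by exists C, h0; split=> // x /H; rewrite yy0.
(* Trees with at most p vertices cancel by the order conditions; larger ones carry a power of h
   beyond p themselves. *)
have res : bigOh hh p.+1 (fun x => \sum_(t <- trees N p) (hh x ^+ rho t *:
    ((wt R t * (\sum_(m < N) \sum_(i < s m) b m i 0 * th t m i - (tdens t)%:R^-1)) *: F t))).
  apply: bigOh_sum => t _; have [tp|tp] := leqP (rho t) p.
    apply: bigOh_eq (bigOh_zero hh _ p.+1) => x.
    by rewrite Hoc ?rho_gt0// subrr mulr0 scale0r scaler0.
  apply: bigOh_weaken tp _; rewrite -[X in bigOh _ X]addn0.
  exact/bigOh_scale_hh/bigOh_cst.
have bnum : bigOh hh p.+1 (fun x => \sum_(m < N) \sum_(i < s m) b m i 0 *:
    ((sval x).2 m i - \sum_(t <- trees N p) (wt R t * th t m i * hh x ^+ rho t) *: F t)).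
  by apply: bigOh_sum => m _; apply: bigOh_sum => i _; exact/bigOh_scale/num.
have [C [h0 [C0 h00 H]]] : bigOh hh p.+1 (fun x => step b y0 (sval x).2 - y (hh x)).
  (* The local error is the numerical remainder minus the exact remainder plus the difference of the
     two tree sums. *)
  apply: bigOh_eq (bigOh_add (bigOh_sub bnum ex) res) => x.
  rewrite /step.
  under [in RHS]eq_bigr do under eq_bigr do rewrite scalerBr.
  under [in RHS]eq_bigr do rewrite sumrB.
  rewrite sumrB.
  set K := (X in y0 + X); set A := (X in K - X); set B := (X in _ - y0 - X).
  set D := (X in _ = _ + X); suff -> : D = A - B.
    by rewrite [RHS]addrAC subrKA opprB subrKA opprB addrA [y0 + K]addrC.
  rewrite /D /A /B.
  under [X in _ = X - _]eq_bigr do under eq_bigr do rewrite scaler_sumr.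
  under [X in _ = X - _]eq_bigr do rewrite exchange_big/=.
  rewrite [X in _ = X - _]exchange_big/= -sumrB; apply: eq_bigr => t _.
  under [X in _ = X - _]eq_bigr do under eq_bigr do rewrite scalerA.
  under [X in _ = X - _]eq_bigr do rewrite -scaler_suml.
  rewrite -scaler_suml scalerA -scalerBl; congr (_ *: _).
  rewrite mulrBr mulrBr; congr (_ - _); last by ring.
  rewrite !mulr_sumr; apply: eq_bigr => m _; rewrite !mulr_sumr.
  by apply: eq_bigr => i _; rewrite /th; ring.
exists C, h0; split=> // h k hh0 hk.
exact: (H (exist _ (h, k) hk)).
Qed.

(** * The test problem attached to a tree *)

Section PolynomialMaps.
Local Open Scope classical_set_scope.
Variables (R : realType) (d : nat).
Local Notation V := 'rV[R]_d.

(** A class of continuous functions closed under directional derivatives, so that smoothness of the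
    test field follows by induction on the list of directions. *)
Inductive polyfun : (V -> R) -> Prop :=
| PolyCst c : polyfun (fun=> c)
| PolyCoord i : polyfun (fun x => x 0 i)
| PolyAdd g h : polyfun g -> polyfun h -> polyfun (fun x => g x + h x)
| PolyMul g h : polyfun g -> polyfun h -> polyfun (fun x => g x * h x).

Lemma is_derive_coord (x v : V) i : is_derive x v (fun z : V => z 0 i) (v 0 i).
Proof.
have did : derivable (id : V -> V) x v by exact: derivable_id.
split; first by move/derivable_mxP: did; apply.
have := derive_mx did; rewrite derive_id => E.
by rewrite [in RHS]E mxE.
Qed.

Lemma is_derive_mul (g h : V -> R) x v dg dh :
  is_derive x v g dg -> is_derive x v h dh ->
  is_derive x v (fun z => g z * h z) (g x * dh + h x * dg).
Proof.
move=> Hg Hh; rewrite (_ : (fun z => g z * h z) = g * h)//.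
exact: is_derive_eq (is_deriveM Hg Hh) _.
Qed.

Lemma polyfun_derive g : polyfun g ->
  exists g', [/\ continuous g, forall x v, is_derive x v g (g' v x)
    & forall v, polyfun (g' v)].
Proof.
elim=> {g} [c|i|g h _ [g' [cg dg pg]] _ [h' [ch dh ph]]|
  g h Pg [g' [cg dg pg]] Ph [h' [ch dh ph]]].
- exists (fun _ _ => 0); split=> [|x v|v];
    [exact: cst_continuous|exact: is_derive_cst|exact: PolyCst].
- exists (fun (v _ : V) => v 0 i).
  by split=> [|x v|v]; [exact: coord_continuous|exact: is_derive_coord|exact: PolyCst].
- exists (fun v x => g' v x + h' v x); split=> [x|x v|v].
  + by apply: continuousD; [exact: cg|exact: ch].
  + exact: is_deriveD.
  + exact: PolyAdd.
- exists (fun v x => g x * h' v x + h x * g' v x); split=> [x|x v|v].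
  + by apply: continuousM; [exact: cg|exact: ch].
  + exact: is_derive_mul.
  + by apply: PolyAdd; apply: PolyMul.
Qed.

Lemma polyfun_smooth e (g : V -> 'rV[R]_e) :
  (forall i, polyfun (fun x => g x 0 i)) -> smooth g.
Proof.
have step (k : V -> 'rV[R]_e) : (forall i, polyfun (fun x => k x 0 i)) ->
    [/\ continuous k, forall v x, derivable k x v
      & forall v i, polyfun (fun x => 'D_v k x 0 i)].
  move=> pk; have dk v x : derivable k x v.
    apply/derivable_mxP => i j; rewrite ord1.
    by have [k' [_ dk _]] := polyfun_derive (pk j); case: (dk x v).
  split=> //.
    move=> x; apply/(@cvgrPdist_le _ _ _ (nbhs x)) => eps eps0.
    have : \forall z \near x, forall i, `|k x 0 i - k z 0 i| <= eps.
      apply: (@filter_forall _ _ (fun i z => `|k x 0 i - k z 0 i| <= eps) _ (nbhs_filter x)).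
      move=> i; have [k' [ck _ _]] := polyfun_derive (pk i).
      by have /(@cvgrPdist_le _ _ _ (nbhs x)) := ck x; apply.
    apply: filterS => z Hz; apply: norm_le_coord; first exact: ltW.
    by move=> i; rewrite !mxE.
  move=> v i; have [k' [_ dk' pk']] := polyfun_derive (pk i).
  rewrite (_ : (fun x => _) = k' v)//; apply/funext => x.
  by rewrite derive_mx// mxE; exact: derive_val.
move=> pg vs; suff : forall i, polyfun (fun x => iderive vs g x 0 i).
  by case/step => c dk _; split.
elim: vs => // v vs IH i.
by have [_ _] := step _ IH; apply.
Qed.

Lemma polyfun_prod (I : Type) (l : seq I) (j : I -> 'I_d) :
  polyfun (fun x => \prod_(u <- l) x 0 (j u)).
Proof.
elim: l => [|u l IH].
  rewrite (_ : (fun _ => _) = (fun=> 1)); first exact: PolyCst.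
  by apply/funext => x; rewrite big_nil.
rewrite (_ : (fun _ => _) = (fun x : V => x 0 (j u) * \prod_(u <- l) x 0 (j u))).
  by apply: PolyMul => //; exact: PolyCoord.
by apply/funext => x; rewrite big_cons.
Qed.

(** At the origin a product of two or more coordinates has zero derivative; this is how the test
    problem reproduces the special role of roots with one child. *)
Lemma is_derive_prod0 (I : Type) (l : seq I) (j : I -> 'I_d) (v : V) :
  is_derive 0 v (fun x : V => \prod_(u <- l) x 0 (j u))
    (if l is [:: u] then v 0 (j u) else 0).
Proof.
have E (u : I) l' : (fun x : V => \prod_(u <- u :: l') x 0 (j u)) =
    (fun x : V => x 0 (j u) * \prod_(u <- l') x 0 (j u)).
  by apply/funext => x; rewrite big_cons.
have D l' : exists c, is_derive 0 v (fun x : V => \prod_(u <- l') x 0 (j u)) c.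
  have [g' [_ dg _]] := polyfun_derive (polyfun_prod l' j).
  by exists (g' v 0); exact: dg.
case: l => [|u l].
  rewrite (_ : (fun _ => _) = cst 1); first exact: is_derive_cst.
  by apply/funext => x; rewrite big_nil.
have [c dc] := D l; rewrite E.
apply: is_derive_eq (is_derive_mul (is_derive_coord 0 v (j u)) dc) _.
rewrite mxE mul0r add0r; case: l {dc} => [|w l]; first by rewrite big_nil mul1r.
by rewrite big_cons mxE !mul0r.
Qed.

End PolynomialMaps.

(** Classical equality on trees, which lets [index] locate a tree in a list of subtrees. *)
HB.instance Definition _ (N : nat) := gen_eqMixin (ctree N).

(** * Subtrees of a colored tree *)

Section Subtrees.
Variable N : nat.
Implicit Types t u : ctree N.

Definition root t := let: CNode m _ := t in m.
Definition children t := let: CNode _ ch := t in ch.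

Fixpoint subtrees t : seq (ctree N) :=
  let: CNode m ch := t in t :: flatten (map subtrees ch).

Lemma ctree_mem_ind (P : ctree N -> Prop) :
  (forall m ch, {in ch, forall t, P t} -> P (CNode m ch)) -> forall t, P t.
Proof.
move=> HP; fix IH 1 => -[m ch]; apply: HP.
elim: ch => [|t ch IHch] u; first by rewrite in_nil; discriminate.
by rewrite inE => /predU1P[->|/IHch]; [exact: IH|].
Qed.

Lemma mem_subtrees t : t \in subtrees t.
Proof. by case: t => m ch; rewrite inE eqxx. Qed.

Lemma subtrees_trans t : {in subtrees t, forall u, {subset subtrees u <= subtrees t}}.
Proof.
elim/ctree_mem_ind: t => m ch IH u; rewrite inE => /predU1P[->//|].
move=> /flattenP[_ /mapP[c cch ->] uc] w wu; rewrite inE; apply/orP; right.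
by apply/flattenP; exists (subtrees c); [exact: map_f|exact: IH uc _ wu].
Qed.

Lemma subtrees_children t u w : u \in subtrees t -> w \in children u -> w \in subtrees t.
Proof.
move=> /subtrees_trans + wu; apply; case: u wu => m ch /= wch.
rewrite inE; apply/orP; right; apply/flattenP.
by exists (subtrees w); [exact: map_f|exact: mem_subtrees].
Qed.

End Subtrees.

(** * Exact solution and exact stages of the test problem; necessity *)

Section TestProblem.
Variables (R : realType) (N : nat) (t0 : ctree N).
Local Notation d := (size (subtrees t0)).+1.

(** Coordinates stand for subtrees. The spare coordinate is there for [inord]; [nth] gives it the
    default [t0], so every coordinate carries a subtree of [t0]. For a repeated subtree [idx] picks
    the first occurrence. *)
Let tr (v : 'I_d) : ctree N := nth t0 (subtrees t0) v.
Let idx (u : ctree N) : 'I_d := inord (index u (subtrees t0)).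

Lemma tr_mem v : tr v \in subtrees t0.
Proof.
have [vd|vd] := ltnP v (size (subtrees t0)); first exact: mem_nth.
by rewrite /tr nth_default// mem_subtrees.
Qed.

Lemma tr_idx u : u \in subtrees t0 -> tr (idx u) = u.
Proof.
by move=> us; rewrite /tr /idx inordK ?nth_index// ltnS ltnW// index_mem.
Qed.

Definition test_field (m : 'I_N) (y : 'rV[R]_d) : 'rV[R]_d :=
  \row_v if root (tr v) == m then \prod_(u <- children (tr v)) y 0 (idx u) else 0.

Lemma test_field_smooth m : smooth (test_field m).
Proof.
apply: polyfun_smooth => v.
under eq_fun do rewrite mxE.
by case: eqP => _; [exact: polyfun_prod|exact: PolyCst].
Qed.

Definition test_solution (t : R) : 'rV[R]_d := \row_v (t ^+ rho (tr v) / (tdens (tr v))%:R).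

(** Only the field of the color of the root acts on a coordinate, and the factor rho from
    differentiation cancels in [tdens]. *)
Lemma test_solution_derive (t : R) :
  is_derive t 1 test_solution (\sum_(m < N) test_field m (test_solution t)).
Proof.
have dv v : is_derive t 1 (fun s => test_solution s 0 v)
    ((\sum_(m < N) test_field m (test_solution t)) 0 v).
  rewrite summxE (bigD1 (root (tr v)))//= big1 ?addr0 => [|m mv]; last first.
    by rewrite mxE eq_sym (negbTE mv).
  have -> : (fun s => test_solution s 0 v) =
      (fun s : R => ((tdens (tr v))%:R^-1 * s ^+ rho (tr v)) *: (1 : R^o)).
    by apply/funext => s; rewrite mxE [_ *: _]mulr1 mulrC.
  apply: is_derive_eq (is_derive_monomial _ _ _ _) _.
  rewrite [_ *: _]mulr1 mxE eqxx.
  have ch u : u \in children (tr v) -> test_solution t 0 (idx u) = t ^+ rho u / (tdens u)%:R.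
    by move=> /(subtrees_children (tr_mem v)) us; rewrite mxE tr_idx.
  rewrite (eq_big_seq _ ch); case: (tr v) => m cs.
  rewrite -[children _]/cs tdensE rhoE -[_.+1.-1]/(\sum_(u <- cs) rho u)%N.
  rewrite natrM invfM natr_prod -prodfV expr_sum big_split/= mulrC -mulrA mulrCA.
  by congr (_ * _); rewrite mulrA mulfV ?mul1r ?pnatr_eq0.
split; first by apply/derivable_mxP => i j; rewrite ord1; case: (dv j).
rewrite derive_mx; last by apply/derivable_mxP => i j; rewrite ord1; case: (dv j).
by apply/matrixP => i j; rewrite ord1 mxE; exact: derive_val.
Qed.

Variables (s : 'I_N -> nat) (alpha gamma : forall q m : 'I_N, 'M[R]_(s q, s m)).
Hypothesis Halpha :
  forall q m (i : 'I_(s q)) (j : 'I_(s m)), (i <= j)%N -> alpha q m i j = 0.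
Hypothesis Hgamma :
  forall q m (i : 'I_(s q)) (j : 'I_(s m)), (i < j)%N -> gamma q m i j = 0.
Local Notation th t q i :=
  (theta alpha (fun q' m' => alpha q' m' + gamma q' m') t q i 0).

Definition test_stage (h : R) q (i : 'I_(s q)) : 'rV[R]_d :=
  \row_v (h ^+ rho (tr v) * th (tr v) q i).

(** Monomials and the starting point 0 leave nothing to truncate: f_q gives the product with alpha
    for any number of children, and its Jacobian at 0 adds gamma exactly when there is one child. *)
Lemma test_stage_eqs h : stage_eqs alpha gamma test_field 0 h (test_stage h).
Proof.
move=> q i; rewrite stage_sum_alpha// stage_sum_gamma// add0r.
set A := \sum_(m < N) _; set G := \sum_(m < N) _; apply/rowP => v.
have -> : (h *: test_field q A + h *: jac (test_field q) 0 G) 0 v =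
    h * (test_field q A 0 v + jac (test_field q) 0 G 0 v).
  by rewrite !mxE mulrDr.
rewrite /jac derive_mx; last exact/smooth_derivable/test_field_smooth.
rewrite !mxE; under [X in derive X]eq_fun do rewrite mxE.
have lin (a : forall q m : 'I_N, 'M[R]_(s q, s m)) u : u \in children (tr v) ->
    (\sum_(m < N) \sum_(j < s m) a q m i j *: test_stage h j) 0 (idx u) =
    h ^+ rho u * \sum_(m < N) \sum_(j < s m) a q m i j * th u m j.
  move=> /(subtrees_children (tr_mem v)) us; rewrite summxE mulr_sumr.
  apply: eq_bigr => m _; rewrite summxE mulr_sumr; apply: eq_bigr => j _.
  by rewrite !mxE tr_idx// mulrCA.
have [rv|rv] := eqVneq (root (tr v)) q; last first.
  rewrite derive_cst addr0 mulr0.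
  by case: (tr v) rv => m ch /= mq; rewrite theta_neq ?mulr0.
rewrite (eq_big_seq _ (lin alpha)).
have -> := @derive_val _ _ _ _ _ _ _ (is_derive_prod0 (children (tr v)) idx G).
case: (tr v) rv lin => m ch; rewrite -[root _]/m -[children _]/ch => -> lin.
rewrite theta_node expr_rho [X in _ * (X + _)]big_split/=.
case: ch lin => [|u [|u' ch]] lin.
- by rewrite !big_nil; ring.
- rewrite !big_seq1 lin ?mem_head// -mulrA; congr (_ * _); rewrite -mulrDr; congr (_ * _).
  rewrite -big_split; apply: eq_bigr => m' _; rewrite -big_split; apply: eq_bigr => j _.
  by rewrite mxE mulrDl.
- by rewrite addr0 mulrA.
Qed.

Lemma tr_idx_self : tr (idx t0) = t0.
Proof. exact/tr_idx/mem_subtrees. Qed.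

Variables (b : forall q : 'I_N, 'cV[R]_(s q)) (p : nat).

(** Dividing the error bound by h^rho(t_0), where rho(t_0) is at most p, leaves a factor h, so the
    defect is below every positive number. *)
Lemma order_condition_necessary : (rho t0 <= p)%N -> has_order b alpha gamma p ->
  \sum_(m < N) \sum_(i < s m) b m i 0 * th t0 m i = (tdens t0)%:R^-1.
Proof.
move=> tp /(_ _ _ test_field_smooth 0 test_solution 1 ltr01).
case=> [|t _|C [h0 [h00 H]]]; last 1 first.
- set c := \sum_(m < N) _; apply/eqP; rewrite -subr_eq0; apply/negPn/negP => c0.
  (* [C] has no sign in [has_order], hence the absolute value; h < 1 reduces the remaining power of
     h to h. *)
  have Hc h : 0 < h < Num.min h0 1 -> `|c - (tdens t0)%:R^-1| <= `|C| * h.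
    rewrite lt_min => /and3P[h_gt0 hh0 h1].
    have := H h (test_stage h) _ (test_stage_eqs h); rewrite h_gt0 hh0 => /(_ isT) Hh.
    have := le_trans (le_coord_norm _ (idx t0)) Hh.
    have -> : (step b 0 (test_stage h) - test_solution h) 0 (idx t0) =
        h ^+ rho t0 * (c - (tdens t0)%:R^-1).
      rewrite /step add0r !mxE summxE tr_idx_self mulrBr; congr (_ - _).
      rewrite mulr_sumr; apply: eq_bigr => m _; rewrite summxE mulr_sumr.
      by apply: eq_bigr => i _; rewrite !mxE tr_idx_self mulrCA.
    rewrite normrM normrX gtr0_norm// -(subnKC tp) -addnS exprD mulrCA.
    rewrite ler_pM2l ?exprn_gt0// => /le_trans; apply.
    apply: le_trans (ler_wpM2r _ (ler_norm C)) _; first by rewrite exprn_ge0 ?ltW.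
    rewrite ler_wpM2l// exprS ler_piMr ?(ltW h_gt0)//.
    by rewrite exprn_ile1// ltW.
  pose x := `|c - (tdens t0)%:R^-1|; have x0 : 0 < x by rewrite normr_gt0.
  have m0 : 0 < Num.min h0 1 by rewrite lt_min h00 ltr01.
  (* For this h one has |C| h <= x / 2, against x <= |C| h. *)
  pose h := Num.min (Num.min h0 1 / 2) (x / (2 * (`|C| + 1))).
  have C1 : 0 < 2 * (`|C| + 1) by rewrite mulr_gt0// ltr_wpDl.
  have h_gt0 : 0 < h by rewrite lt_min !divr_gt0.
  have hm : h < Num.min h0 1.
    by rewrite (le_lt_trans (_ : _ <= Num.min h0 1 / 2)) ?ge_min ?lexx//; lra.
  have := Hc h; rewrite h_gt0 hm => /(_ isT); rewrite -/x.
  have : h <= x / (2 * (`|C| + 1)) by rewrite ge_min lexx orbT.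
  rewrite ler_pdivlMr//; have := normr_ge0 C; nra.
- by apply/rowP => v; rewrite !mxE expr0n eqn0Ngt rho_gt0 mul0r.
- exact: test_solution_derive.
Qed.

End TestProblem.

Theorem mainTheorem3 (R : realType) (N : nat) (s : 'I_N -> nat)
  (b : forall q : 'I_N, 'cV[R]_(s q))
  (alpha gamma : forall q m : 'I_N, 'M[R]_(s q, s m))
  (Halpha : forall q m (i : 'I_(s q)) (j : 'I_(s m)), (i <= j)%N -> alpha q m i j = 0)
  (Hgamma : forall q m (i : 'I_(s q)) (j : 'I_(s m)), (i < j)%N -> gamma q m i j = 0)
  (p : nat) :
  has_order b alpha gamma p <->
  (forall t : ctree N, (1 <= rho t <= p)%N ->
     \sum_(m < N) \sum_(i < s m) b m i 0 *
        theta alpha (fun q m => alpha q m + gamma q m) t m i 0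
     = (tdens t)%:R^-1).
Proof.
split; last exact: order_conditions_sufficient.
by move=> ho t /andP[_ tp]; exact: order_condition_necessary ho.
Qed.
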